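(* Let $\alpha,\beta,\gamma$ be integers with $1\le\alpha\le\beta\le\gamma\le2(\alpha+\beta)$ such that $\alpha+\beta+\gamma$ is divisible by three, and let $t=\frac13(\alpha+\beta+\gamma)$. Set $\lambda=\frac13(2(\alpha+\beta)-\gamma)$. Then the matrix $M=M(\alpha,\beta,\gamma,t)$ is the $\lambda\times\lambda$ matrix with entry $(i,j)$ given by $$M_{(i,j)}=\binom{\gamma+t}{\beta+t+1-i-j}\qquad(1\le i,j\le\lambda),$$ and its determinant is $$\det M=(-1)^{\binom{\lambda}{2}}\,\frac{\mathcal H(2t-\gamma)\,\mathcal H(2t-\beta)\,\mathcal H(2t-\alpha)\,\mathcal H(\alpha+\beta+\gamma)}{\mathcal H(\alpha+t)\,\mathcal H(\beta+t)\,\mathcal H(\gamma+t)}.$$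
   Context: For an integer $n\ge0$, the hyperfactorial is $\mathcal H(n)=\prod_{i=0}^{n-1} i!$, with $\mathcal H(0)=1$. Binomial coefficients $\binom{a}{b}$ with $a\ge 0$ are $0$ if $b<0$ or $b>a$. The determinant of the empty ($0\times0$) matrix is $1$. For integers $1\le\alpha\le\beta\le\gamma\le 2(\alpha+\beta)$ with $3\mid\alpha+\beta+\gamma$ and $t\ge\frac13(\alpha+\beta+\gamma)$, let $M=M(\alpha,\beta,\gamma,t)$ be the square integer matrix of size $n=t+\frac13(\alpha+\beta-2\gamma)$ defined as follows. Its first $m=t-\frac13(\alpha+\beta+\gamma)$ rows have entries $$M_{(i,j)}=\binom{\gamma}{\frac13(\alpha+\beta+\gamma)+i-j}\quad(1\le i\le m,\ 1\le j\le n),$$ and its last $\frac13(2(\alpha+\beta)-\gamma)$ rows have entries $$M_{(m+k,j)}=\binom{\gamma+t}{t+\beta+1-k-j}\quad(1\le k\le\tfrac13(2(\alpha+\beta)-\gamma),\ 1\le j\le n).$$ *)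

(* Defs.v *)
From mathcomp Require Import all_boot all_order all_algebra.
From mathcomp Require Import zify.

Set Implicit Arguments.
Unset Strict Implicit.
Unset Printing Implicit Defensive.

Import Order.TTheory GRing.Theory Num.Theory.
Local Open Scope ring_scope.

Definition hyperfact (n : nat) : nat := (\prod_(i < n) i`!)%N.

(* The lower index may be negative, so it cannot be a (truncated) nat. *)
Definition binomz (a : nat) (b : int) : int :=
  if b is Posz k then Posz 'C(a, k) else 0.

(* In the range of parameters considered, all the nat subtractions below are
   exact and all the divisions by 3 are exact; 3 * t is put under the quotient
   in [Mdim] because alpha + beta - 2 * gamma itself may be negative. *)
Definition Mdim (alpha beta gamma t : nat) : nat :=
  ((3 * t + alpha + beta - 2 * gamma) %/ 3)%N.

Definition Mtop (alpha beta gamma t : nat) : nat :=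
  (t - (alpha + beta + gamma) %/ 3)%N.

Lemma Mdim_split (alpha beta gamma t : nat) :
  (gamma <= 2 * (alpha + beta))%N -> (3 %| alpha + beta + gamma)%N ->
  ((alpha + beta + gamma) %/ 3 <= t)%N ->
  Mdim alpha beta gamma t =
    (Mtop alpha beta gamma t + (2 * (alpha + beta) - gamma) %/ 3)%N.
Proof. by rewrite /Mdim /Mtop; lia. Qed.

(* Ordinals start at 0: the 1-based row and column indices are i.+1 and j.+1,
   and row m + k has k = (i - m).+1. *)
Definition Mmx (alpha beta gamma t : nat) : 'M[int]_(Mdim alpha beta gamma t) :=
  let m := Mtop alpha beta gamma t in
  \matrix_(i, j)
    if (i < m)%N then
      binomz gamma (((alpha + beta + gamma) %/ 3)%N%:Z + i.+1%:Z - j.+1%:Z)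
    else
      binomz (gamma + t)
        (t%:Z + beta%:Z + 1 - (i - m).+1%N%:Z - j.+1%:Z).

(* Main.v *)
Require Import Defs.
From mathcomp Require Import all_boot all_order all_algebra.
From mathcomp Require Import zify ring.

Import Order.TTheory GRing.Theory Num.Theory.
Local Open Scope ring_scope.

(** The matrix is [binomz (p + q) (q + i - j)] with its rows reversed, where
    [p = 2t - beta] and [q = 2t - alpha].  Right multiplication by the
    unitriangular Pascal matrix ['C(j, l)] turns this into
    ['C(p + q + j, q + i)] (Vandermonde's convolution).  Up to factorials that
    depend on the row or on the column only, that entry is ['C(p + j, i)], and
    the same convolution with [q = 0] shows that the latter matrix has
    determinant 1. *)

Lemma sum_binomz_bin (n N k j : nat) : (j < n)%N ->
  \sum_(l < n) binomz N (k%:Z - l%:Z) * ('C(j, l))%:Z = ('C(N + j, k))%:Z.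
Proof.
move=> ltjn; rewrite addnC -binomial.Vandermonde.
pose F l := binomz N (k%:Z - l%:Z) * ('C(j, l))%:Z.
have F0 l : (j < l)%N || (k < l)%N -> F l = 0.
  rewrite /F; case/orP => h; first by rewrite bin_small ?mulr0.
  have -> : k%:Z - l%:Z = Negz (l - k).-1 by lia.
  by rewrite mul0r.
(* Vandermonde sums over [l <= k], the goal over [l < n]; [F] vanishes beyond either [j] or [k], so
   both sums extend to the common range [l < n + k.+1]. *)
have widen m : (forall l, (m <= l)%N -> F l = 0) -> (m <= n + k.+1)%N ->
    \sum_(l < m) F l = \sum_(l < n + k.+1) F l.
  move=> F0m le_m; rewrite (big_ord_widen _ F le_m) big_mkcond /=.
  by apply: eq_bigr => l _; case: ltnP => // /F0m.
rewrite (widen n) ?leq_addr //; last by move=> l h; apply: F0; lia.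
rewrite -(widen k.+1) ?leq_addl //; last by move=> l h; apply: F0; lia.
rewrite -natz natr_sum; apply: eq_bigr => l _.
have -> : F l = binomz N (k - l)%N%:Z * ('C(j, l))%:Z.
  by rewrite /F subzn // -ltnS.
by rewrite natz PoszM mulrC.
Qed.

Lemma det_binomz_shift (n N q : nat) :
  \det (\matrix_(i < n, j < n) binomz N (q%:Z + i%:Z - j%:Z)) =
  \det (\matrix_(i < n, j < n) ('C(N + j, q + i))%:Z).
Proof.
pose U : 'M[int]_n := \matrix_(l, j) ('C(j, l))%:Z.
have detU : \det U = 1.
  rewrite -det_tr det_trig; last first.
    by apply/is_trig_mxP => i j ltij; rewrite !mxE bin_small.
  by rewrite big1 // => i _; rewrite !mxE binn.
rewrite -[LHS]mulr1 -detU -det_mulmx; congr (\det _).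
apply/matrixP => i j; rewrite !mxE -(@sum_binomz_bin n) //.
by apply: eq_bigr => l _; rewrite !mxE PoszD.
Qed.

Lemma det_bin_unit (n p : nat) :
  \det (\matrix_(i < n, j < n) ('C(p + j, i))%:Z) = 1.
Proof.
(* The shift is undone: the entries [binomz p (i - j)] are 1 on the diagonal and, their lower index
   being negative, 0 above it. *)
rewrite -(det_binomz_shift n p 0) det_trig.
  by rewrite big1 // => i _; rewrite !mxE add0r subrr /= bin0.
apply/is_trig_mxP => i j ltij; rewrite !mxE add0r.
by have -> : i%:Z - j%:Z = Negz (j - i).-1 by lia.
Qed.

(** For [i <= p + j] both sides are [(p + q + j)! (p + j)! / (p + j - i)!]; otherwise both binomials
    vanish. *)
Lemma bin_shift_fact (p q i j : nat) :
  ((q + i)`! * 'C(p + q + j, q + i) * (p + j)`! =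
   i`! * 'C(p + j, i) * (p + q + j)`!)%N.
Proof.
have [le_i|lt_i] := leqP i (p + j); last by rewrite !bin_small ?muln0 //; lia.
have e1 : (p + q + j - (q + i) = p + j - i)%N by lia.
have h1 : ('C(p + q + j, q + i) * ((q + i)`! * (p + j - i)`!) = (p + q + j)`!)%N.
  by rewrite -e1 bin_fact //; lia.
have h2 := bin_fact le_i.
rewrite -h2 -h1; ring.
Qed.

Lemma det_scale (R : comPzRingType) (n : nat) (r c : 'I_n -> R) (A : 'M[R]_n) :
  \det (\matrix_(i, j) (r i * A i j * c j)) =
  (\prod_i r i) * \det A * (\prod_j c j).
Proof.
have -> : \matrix_(i, j) (r i * A i j * c j) =
    diag_mx (\row_i r i) *m A *m diag_mx (\row_j c j).
  by apply/matrixP => i j; rewrite mul_mx_diag mul_diag_mx !mxE.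
rewrite !det_mulmx !det_diag.
by congr (_ * _ * _); apply: eq_bigr => i _; rewrite mxE.
Qed.

Lemma hyperfactD (c n : nat) :
  hyperfact (c + n) = (hyperfact c * \prod_(i < n) (c + i)`!)%N.
Proof. by rewrite /hyperfact big_split_ord. Qed.

Lemma hyperfact_gt0 (n : nat) : (0 < hyperfact n)%N.
Proof. by apply: prodn_gt0 => i; apply: fact_gt0. Qed.

(** This is MacMahon's count of plane partitions in an [n] by [p] by [q] box, with denominators
    cleared so as to stay in [int]. Products of consecutive factorials are quotients of
    hyperfactorials. *)
Lemma det_binomz_toeplitz (n p q : nat) :
  \det (\matrix_(i < n, j < n) binomz (p + q) (q%:Z + i%:Z - j%:Z)) *
    (hyperfact (p + n) * hyperfact (q + n) * hyperfact (p + q))%N%:Z =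
  (hyperfact n * hyperfact p * hyperfact q * hyperfact (p + q + n))%N%:Z.
Proof.
rewrite det_binomz_shift; set A := \matrix_(i, j) _.
have /(congr1 determinant) : \matrix_(i, j)
      ((q + i)`!%:Z * A i j * (p + j)`!%:Z) =
    \matrix_(i, j) (i`!%:Z *
      (\matrix_(i < n, j < n) ('C(p + j, i))%:Z) i j * (p + q + j)`!%:Z).
  by apply/matrixP => i j; rewrite !mxE -!PoszM bin_shift_fact.
rewrite !det_scale det_bin_unit mulr1.
rewrite (hyperfactD p n) (hyperfactD q n) (hyperfactD (p + q)) => h.
have cast (f : 'I_n -> nat) : (\prod_i f i)%N%:Z = \prod_i (f i)%:Z.
  by rewrite -natz natr_prod; apply: eq_bigr => i _; rewrite natz.
move: h; rewrite -!cast -/(hyperfact n) => h.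
(* The goal is [h] multiplied by [hyperfact p * hyperfact q * hyperfact (p + q)]. *)
transitivity ((\prod_(i < n) (q + i)`!)%N%:Z * \det A *
   (\prod_(i < n) (p + i)`!)%N%:Z *
   (hyperfact p * hyperfact q * hyperfact (p + q))%N%:Z).
  rewrite !PoszM; ring.
rewrite h !PoszM; ring.
Qed.

(** The first row has its only 1 in the last column, with cofactor sign [(-1) ^+ n], and
    ['C(n.+1, 2) = 'C(n, 2) + n]. *)
Lemma det_antidiag (R : comPzRingType) (n : nat) :
  \det (\matrix_(i < n, j < n) (i + j == n.-1)%N%:R) = (-1) ^+ 'C(n, 2) :> R.
Proof.
elim: n => [|n IHn]; first by rewrite det_mx00.
rewrite (expand_det_row _ ord0) (bigD1 ord_max) //= big1 ?addr0; last first.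
  move=> j; rewrite -val_eqE /= mxE /= add0n => /negPf ->.
  by rewrite mul0r.
rewrite mxE /= add0n eqxx mul1r /cofactor add0n binS bin1 addnC exprD -IHn.
congr (_ * \det _); apply/matrixP => i j; rewrite !mxE /= /bump /=.
by congr (_%:R); have := ltn_ord i; have := ltn_ord j; lia.
Qed.

(** Left multiplication by the antidiagonal matrix replaces row [i] by row [n - 1 - i], and
    [q + (n - 1 - i) - j] is the lower index on the left. *)
Lemma det_binomz_hankel (n p q : nat) :
  \det (\matrix_(i < n, j < n)
          binomz (p + q) (q%:Z + n%:Z + 1 - i.+1%:Z - j.+1%:Z)) =
  (-1) ^+ 'C(n, 2) *
  \det (\matrix_(i < n, j < n) binomz (p + q) (q%:Z + i%:Z - j%:Z)).
Proof.
rewrite -det_antidiag -det_mulmx; congr (\det _); apply/matrixP => i j.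
rewrite !mxE (bigD1 (rev_ord i)) //= big1 ?addr0 => [|k]; last first.
  rewrite -val_eqE /= !mxE => ne.
  suff -> : (i + k == n.-1)%N = false by rewrite mul0r.
  by have := ltn_ord i; lia.
rewrite !mxE /=; have lti := ltn_ord i.
have -> : (i + (n - i.+1) == n.-1)%N by lia.
by rewrite mul1r; congr (binomz _ _); lia.
Qed.

Theorem theorem4p5 (alpha beta gamma t lambda : nat)
  (h1alpha : (1 <= alpha)%N)
  (halphabeta : (alpha <= beta)%N)
  (hbetagamma : (beta <= gamma)%N)
  (hgamma : (gamma <= 2 * (alpha + beta))%N)
  (hdvd : (3 %| alpha + beta + gamma)%N)
  (ht : t = ((alpha + beta + gamma) %/ 3)%N)
  (hlambda : lambda = ((2 * (alpha + beta) - gamma) %/ 3)%N) :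
  (exists e : Mdim alpha beta gamma t = lambda,
      castmx (e, e) (Mmx alpha beta gamma t) =
      \matrix_(i < lambda, j < lambda)
        binomz (gamma + t) (beta%:Z + t%:Z + 1 - i.+1%:Z - j.+1%:Z))
  /\
  (\det (Mmx alpha beta gamma t))%:~R =
    (-1) ^+ 'C(lambda, 2) *
    (((hyperfact (2 * t - gamma))%:R * (hyperfact (2 * t - beta))%:R *
      (hyperfact (2 * t - alpha))%:R *
      (hyperfact (alpha + beta + gamma))%:R) /
     ((hyperfact (alpha + t))%:R * (hyperfact (beta + t))%:R *
      (hyperfact (gamma + t))%:R)) :> rat.
Proof.
have e : Mdim alpha beta gamma t = lambda by rewrite /Mdim; lia.
have eM : castmx (e, e) (Mmx alpha beta gamma t) =
    \matrix_(i < lambda, j < lambda)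
      binomz (gamma + t) (beta%:Z + t%:Z + 1 - i.+1%:Z - j.+1%:Z).
  (* At the smallest [t] the upper block of rows is empty. *)
  have m0 : Mtop alpha beta gamma t = 0%N by rewrite /Mtop -ht subnn.
  apply/matrixP => i j; rewrite castmxE !mxE m0 ltn0 subn0 /=.
  by congr (binomz _ _); rewrite addrAC; lia.
split; first by exists e.
have -> : \det (Mmx alpha beta gamma t) =
    \det (castmx (e, e) (Mmx alpha beta gamma t)).
  by case: _ / e {eM}; rewrite castmx_id.
rewrite {}eM.
(* Since [3 * t = alpha + beta + gamma], one has [t + lambda = alpha + beta]; hence
   [beta + t = q + lambda], as the reversed form requires, and the box has sides [lambda], [p],
   [q]. *)
pose p := (2 * t - beta)%N; pose q := (2 * t - alpha)%N.
rewrite -/p -/q.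
have -> : (2 * t - gamma = lambda)%N by lia.
have -> : (gamma + t = p + q)%N by rewrite /p /q; lia.
have -> : (alpha + t = p + lambda)%N by rewrite /p; lia.
have -> : (beta + t = q + lambda)%N by rewrite /q; lia.
have -> : (alpha + beta + gamma = p + q + lambda)%N by rewrite /p /q; lia.
have -> : \matrix_(i < lambda, j < lambda)
      binomz (p + q) (beta%:Z + t%:Z + 1 - i.+1%:Z - j.+1%:Z) =
    \matrix_(i < lambda, j < lambda)
      binomz (p + q) (q%:Z + lambda%:Z + 1 - i.+1%:Z - j.+1%:Z).
  by apply/matrixP => i j; rewrite !mxE; congr (binomz _ _); rewrite /q; lia.
rewrite det_binomz_hankel rmorphM /= rmorphXn rmorphN1; congr (_ * _).
have := congr1 (fun x : int => x%:~R : rat) (det_binomz_toeplitz lambda p q).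
rewrite rmorphM /= -!pmulrn !natrM => h.
have nz m : (hyperfact m)%:R != 0 :> rat by rewrite pnatr_eq0 -lt0n hyperfact_gt0.
by apply/(canRL (mulfK _)); rewrite ?mulf_neq0 //.
Qed.
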